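(* Let $\mathfrak{N}$ be a nest in a vector space $\mathfrak{X}$ over a field $\mathbb{F}$ and let $\mathcal{A}=\operatorname{Alg}\mathfrak{N}$. Suppose that $T$ is a finite rank operator in $\mathcal{A}$. Then $T$ is the sum of $n$ rank-one operators in $\mathcal{A}$, where $n=\operatorname{rank}T$.
   Context: $\mathfrak{X}$ is an arbitrary vector space over a field $\mathbb{F}$, and $\mathcal{L}(\mathfrak{X})$ is the algebra of all linear operators $\mathfrak{X}\to\mathfrak{X}$. A nest $\mathfrak{N}$ in $\mathfrak{X}$ is a set of subspaces of $\mathfrak{X}$, totally ordered by inclusion, containing $\{0\}$ and $\mathfrak{X}$, and complete, i.e. closed under arbitrary intersections and arbitrary unions of its members (the empty union being $\{0\}$ and the empty intersection being $\mathfrak{X}$). $\operatorname{Alg}\mathfrak{N}$ is the algebra of all $T\in\mathcal{L}(\mathfrak{X})$ with $T(M)\subseteq M$ for every $M\in\mathfrak{N}$. The rank of an operator is the dimension of its range. An empty sum is the zero operator. *)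

(* Defs.v *)
From mathcomp Require Import all_boot all_order all_algebra.
From mathcomp Require Import boolp classical_sets.

Set Implicit Arguments.
Unset Strict Implicit.
Unset Printing Implicit Defensive.

Import GRing.Theory.
Local Open Scope classical_set_scope.
Local Open Scope ring_scope.

(* Each family in the union clause is required to be nonempty: the empty union
   is by convention {0} (not the empty set), and {0} is in N by [nest0]. The
   empty intersection is the whole space, so [nestI] needs no such proviso. *)
Record is_nest (F : fieldType) (X : lmodType F) (N : set (set X)) : Prop :=
  IsNest {
    nest_subspace : forall M : set X, N M -> submod_closed (mem M);
    nest_total : total_on N (@subset X);
    nest0 : N [set 0];
    nestT : N setT;
    nestI : forall C : set (set X), C `<=` N -> N (\bigcap_(M in C) M);
    nestU : forall C : set (set X),
      C !=set0 -> C `<=` N -> N (\bigcup_(M in C) M) }.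

Definition Alg (F : fieldType) (X : lmodType F) (N : set (set X)) :
    set {linear X -> X} :=
  [set T | forall M : set X, N M -> T @` M `<=` M].

Definition lin_indep (F : fieldType) (X : lmodType F) (n : nat)
    (e : 'I_n -> X) : Prop :=
  forall c : 'I_n -> F, \sum_(i < n) c i *: e i = 0 -> forall i, c i = 0.

Definition lin_span (F : fieldType) (X : lmodType F) (n : nat)
    (e : 'I_n -> X) : set X :=
  [set x | exists c : 'I_n -> F, x = \sum_(i < n) c i *: e i].

Definition has_dim (F : fieldType) (X : lmodType F) (U : set X) (n : nat) :
    Prop :=
  exists e : 'I_n -> X, lin_indep e /\ lin_span e = U.

(* [has_rank T n] says that T has finite rank and that its rank is n. *)
Definition has_rank (F : fieldType) (X : lmodType F) (T : {linear X -> X})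
    (n : nat) : Prop :=
  has_dim (range T) n.

(* Main.v *)
Require Import Defs.
From HB Require Import structures.
From mathcomp Require Import all_boot all_order all_algebra.
From mathcomp Require Import boolp classical_sets.

(** A finite rank operator can be written as a sum of [e_i (x) f_i], where [e]
    is a basis of its range and the functional [f_i] reads off the [i]-th
    coordinate of [T x]. There are exactly [rank T] terms, and each has rank
    one because [e_i] itself lies in the range, so that [f_i] is nonzero.
    Whether the terms belong to [Alg N] depends only on the choice of the basis.

    Call [e] adapted to the nest if, for each member [M], the part of the range
    inside [M] is spanned by the basis vectors that lie in [M]. For such a basis
    let [x] be in [M]; since [T x] is in [M], its coordinates on the basis
    vectors outside [M] vanish. So each term [f_i x *: e_i] is zero or a multiple
    of a vector of [M], and either way it lies in [M].

    Thus all that is needed is that a chain of subspaces of a finite dimensional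
    space has an adapted basis ([adapted_basis]). This follows by induction on
    the dimension: the traces on [U] of the members that do not contain [U] have
    a largest element ([chain_trace_bound]), a proper subspace of [U]; an adapted
    basis of it, completed arbitrarily to [U], is adapted to the whole chain.
    The chain lives in an arbitrary space, so it is first pulled back to the
    space of coordinates ['rV_n] of the range. *)

Set Implicit Arguments.
Unset Strict Implicit.
Unset Printing Implicit Defensive.

Import GRing.Theory.
Local Open Scope classical_set_scope.
Local Open Scope ring_scope.

Lemma ex_max_dim (F : fieldType) (V : vectType F) (P : set {vspace V}) :
  P !=set0 ->
  exists2 U, P U & forall W, P W -> (\dim W <= \dim U)%N.
Proof.
move=> [U0 PU0].
pose has_dimb k := `[< exists2 U, P U & \dim U = k >].
have has_dimbP : exists k, has_dimb k.
  by exists (\dim U0); apply/asboolP; exists U0.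
have bounded k : has_dimb k -> (k <= \dim {:V})%N.
  by move=> /asboolP[U _ <-]; rewrite dimvS ?subvf.
case: (ex_maxnP has_dimbP bounded) => k /asboolP[U PU <-] max_k.
by exists U => // W PW; apply/max_k/asboolP; exists W.
Qed.

(** Among the subspaces contained in [P], one of maximal dimension must absorb
    every vector of [P]. *)
Lemma vspace_of_submod (F : fieldType) (V : vectType F) (P : set V) :
  P 0 -> (forall a u v, P u -> P v -> P (a *: u + v)) ->
  exists U : {vspace V}, forall v, v \in U <-> P v.
Proof.
move=> P0 Plin.
have [|U UP maxU] :=
    @ex_max_dim F V [set U : {vspace V} | forall v, v \in U -> P v].
  by exists 0%VS => v; rewrite memv0 => /eqP->.
exists U => v; split=> [|Pv]; first exact: UP.
have leUv : (\dim (U + <[v]>) <= \dim U)%N.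
  apply: maxU => w /memv_addP[u uU [w' /vlineP[a ->] ->]].
  by rewrite addrC; apply: Plin => //; apply: UP.
have/eqP-> : U == (U + <[v]>)%VS by rewrite eqEdim addvSl.
by rewrite (subvP (addvSr _ _)) ?memv_line.
Qed.

(** Traces on [U] of a chain are again comparable, so one of maximal dimension,
    among those of the members that do not contain [U], contains all of these.
    If every member contains [U], the bound is [0]; this is where [U != 0] makes
    it proper. *)
Lemma chain_trace_bound (F : fieldType) (V : vectType F)
    (C : set {vspace V}) (U : {vspace V}) :
  total_on C (fun A B => (A <= B)%VS) -> U != 0%VS ->
  exists2 W : {vspace V}, (W <= U)%VS && ~~ (U <= W)%VS &
    forall M, C M -> ~~ (U <= M)%VS -> (U :&: M <= W)%VS.
Proof.
move=> chainC nzU.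
pose traces :=
  [set W | exists2 M, C M & ~~ (U <= M)%VS /\ W = (U :&: M)%VS].
have [traces0 | no_trace] := pselect (traces !=set0); last first.
  exists 0%VS; first by rewrite sub0v subv0.
  by move=> M CM nUM; case: no_trace; exists (U :&: M)%VS, M.
have [_ [M CM [nUM ->]] maxM] := ex_max_dim traces0.
exists (U :&: M)%VS; first by rewrite capvSl subv_cap subvv.
move=> M' CM' nUM'.
have [leM'|leM] := chainC _ _ CM' CM; first exact: capvS.
have/eqP<- // : (U :&: M)%VS == (U :&: M')%VS.
by rewrite eqEdim capvS //= maxM //; exists M'.
Qed.

(** Completing an adapted basis of the bound [W] costs nothing: a member that
    contains [U] contains every added vector, and the trace of any other member
    lies in [W], where the added vectors are not used. *)
Lemma adapted_basis (F : fieldType) (V : vectType F)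
    (C : set {vspace V}) (U : {vspace V}) :
  total_on C (fun A B => (A <= B)%VS) ->
  exists2 s : seq V, basis_of U s &
    forall M, C M -> (U :&: M <= <<[seq v <- s | v \in M]>>)%VS.
Proof.
move=> chainC; have [k] := ubnP (\dim U); elim: k U => // k IHk U ltUk.
have [->|nzU] := eqVneq U 0%VS.
  exists [::]; first by rewrite basisEfree nil_free span_nil sub0v dimv0.
  by move=> M _; rewrite cap0v sub0v.
have [W /andP[sWU nsUW] Wbound] := chain_trace_bound chainC nzU.
have ltWU : (\dim W < \dim U)%N.
  rewrite ltnNge; apply: contra nsUW => leUW.
  by have/eqP-> : W == U by rewrite eqEdim sWU.
have [s bs adapted_s] := IHk W (leq_trans ltWU ltUk).
pose t := s ++ vbasis (U :\: W).
have capUW : (U :&: W)%VS = W by apply/capv_idPr.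
have bt : basis_of U t.
  rewrite -[U](addv_diff_cap U W) capUW addvC.
  apply: cat_basis => //; last exact: vbasisP.
  by apply/directv_addP; rewrite capvC capv_diff.
exists t => // M CM.
have [sUM|nsUM] := boolP (U <= M)%VS.
  have/all_filterP-> : all [in M] t.
    by apply/allP=> v /(basis_mem bt)/(subvP sUM).
  by rewrite (span_basis bt) capvSl.
apply: (@subv_trans _ _ (W :&: M)%VS).
  by rewrite subv_cap Wbound // capvSr.
apply: subv_trans (adapted_s M CM) _.
by rewrite filter_cat span_cat addvSl.
Qed.

(** Turns the span form of adaptedness into the vanishing of coordinates that
    puts the rank-one terms in the nest algebra. *)
Lemma coord_span_filter (F : fieldType) (V : vectType F) (n : nat)
    (s : n.-tuple V) (p : pred V) (i : 'I_n) (v : V) :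
  free s -> v \in <<[seq w <- s | p w]>>%VS -> ~~ p s`_i -> coord s i v = 0.
Proof.
move=> frs vs npi; rewrite (coord_span (X := in_tuple [seq w <- s | p w]) vs).
rewrite linear_sum big1 // => j _.
rewrite linearZ /=.
set w := _`_j.
have : w \in [seq w <- s | p w] by rewrite mem_nth.
rewrite mem_filter => /andP[pw /tnthP[l defw]].
move: pw; rewrite defw (tnth_nth 0) coord_free //.
by case: eqVneq => [->|_]; [rewrite (negPf npi) | rewrite mulr0].
Qed.

Section RankOne.

Variables (F : fieldType) (X : lmodType F) (f : {linear X -> F^o}) (u : X).

(** The type constraint makes the scalar act through [F] rather than [F^o]. *)
Definition rank_one (x : X) : X := (f x : F) *: u.

Fact rank_one_is_linear : linear rank_one.
Proof. by move=> a x y; rewrite /rank_one linearP scalerDl scalerA. Qed.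

HB.instance Definition _ :=
  GRing.isLinear.Build F X X *:%R rank_one rank_one_is_linear.

Lemma has_rank_rank_one (x : X) : f x != 0 -> u != 0 -> has_rank rank_one 1.
Proof.
move=> nzfx nzu; exists (fun=> u); split.
  move=> c; rewrite big_ord1 => /eqP; rewrite scaler_eq0 (negPf nzu) orbF.
  by move=> /eqP c0 i; rewrite ord1.
apply/seteqP; split=> [y [c ->]|_ [y _ <-]]; last first.
  by exists (fun=> f y); rewrite big_ord1.
rewrite big_ord1; exists ((c ord0 / f x) *: x) => //.
have fE : f ((c ord0 / f x) *: x) = c ord0 by rewrite linearZ; apply: divfK.
by rewrite /= /rank_one fE.
Qed.

End RankOne.

(** Moves the problem to a finite dimensional space: subspaces of [X] pull back
    along [phi], and the coordinates of [T x] are functionals of [g x]. The map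
    [g] is obtained by choosing preimages under [phi] pointwise; it is linear
    because [phi] is injective. *)
Lemma rank_factorization (F : fieldType) (X : lmodType F)
    (T : {linear X -> X}) (n : nat) :
  has_rank T n ->
  exists (phi : {linear 'rV[F]_n -> X}) (g : {linear X -> 'rV[F]_n}),
    [/\ injective phi, forall c, exists x, g x = c & forall x, phi (g x) = T x].
Proof.
move=> [e [indep_e span_e]].
pose comb (c : 'rV[F]_n) := \sum_(i < n) c 0 i *: e i.
have comb_lin : linear comb.
  move=> a c d; rewrite scaler_sumr -big_split; apply: eq_bigr => i _.
  by rewrite !mxE scalerDl scalerA.
pose phiL := GRing.isLinear.Build F 'rV[F]_n X *:%R comb comb_lin.
pose phi : {linear 'rV[F]_n -> X} := HB.pack comb phiL.
have phi_inj : injective phi.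
  move=> c d /eqP; rewrite -subr_eq0 -raddfB => /eqP/indep_e cd0.
  apply/rowP=> i; apply/eqP; rewrite -subr_eq0.
  by move: (cd0 i); rewrite !mxE => ->.
have phi_onto x : exists c, phi c = T x.
  have : range T (T x) by exists x.
  rewrite -span_e => -[c ->]; exists (\row_i c i).
  by apply: eq_bigr => i _; rewrite mxE.
have [g gE] := choice phi_onto.
have g_lin : linear g.
  by move=> a x y; apply: phi_inj; rewrite linearP !gE linearP.
pose gL := GRing.isLinear.Build F X 'rV[F]_n *:%R g g_lin.
pose gl : {linear X -> 'rV[F]_n} := HB.pack g gL.
exists phi, gl; split=> // c.
have : range T (phi c) by rewrite -span_e; exists (c 0).
by move=> [x _ Tx]; exists x; apply: phi_inj; rewrite gE.
Qed.

Theorem theorem7 (F : fieldType) (X : lmodType F) (N : set (set X))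
    (hN : is_nest N) (T : {linear X -> X}) (hT : Alg N T)
    (n : nat) (hrank : has_rank T n) :
  exists S : 'I_n -> {linear X -> X},
    (forall i, Alg N (S i) /\ has_rank (S i) 1) /\
    (forall x : X, T x = \sum_(i < n) S i x).
Proof.
have [phi [g [phi_inj g_onto phi_g]]] := rank_factorization hrank.
have N0 M : N M -> M 0.
  by move=> /(nest_subspace hN)[/set_mem].
have Nlin M a u v : N M -> M u -> M v -> M (a *: u + v).
  move=> /(nest_subspace hN)[_ lin] Mu Mv.
  by apply/set_mem/lin; apply/mem_set.
pose C := [set W : {vspace 'rV[F]_n} |
  exists2 M, N M & forall c, c \in W <-> M (phi c)].
have chainC : total_on C (fun A B => (A <= B)%VS).
  move=> A B [M NM AM] [M' NM' BM'].
  have [sMM'|sM'M] := nest_total hN NM NM'; [left|right].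
    by apply/subvP=> c /AM/sMM'/BM'.
  by apply/subvP=> c /BM'/sM'M/AM.
have [s0 bs0 adapted] := adapted_basis fullv chainC.
have size_s0 : size s0 == n.
  by rewrite -(size_basis (X := in_tuple s0) bs0) dimvf /dim /= mul1n.
pose s : n.-tuple 'rV[F]_n := Tuple size_s0.
have free_s : free s by apply: basis_free bs0.
pose f i : {linear X -> F^o} := coord s i \o g.
exists (fun i => rank_one (f i) (phi s`_i)); split=> [i|x]; last first.
  rewrite -phi_g {1}(coord_basis (X := s) bs0 (memvf (g x))) linear_sum.
  by apply: eq_bigr => i _; rewrite linearZ.
split.
  move=> M NM _ [x Mx <-]; rewrite /= /rank_one.
  have [W WM] : exists W : {vspace 'rV[F]_n}, forall c, c \in W <-> M (phi c).
    apply: (@vspace_of_submod _ _ (phi @^-1` M)) => [|a u v Mu Mv] /=.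
      by rewrite linear0; apply: N0.
    by rewrite linearP; apply: Nlin.
  have CW : C W by exists M.
  have gW : g x \in W by apply/WM; rewrite phi_g; apply: hT => //; exists x.
  have [siW|nsiW] := boolP (s`_i \in W).
    by rewrite -[_ *: _]addr0; apply: Nlin; [|apply/WM|apply: N0].
  have gxspan : g x \in <<[seq c <- s | c \in W]>>%VS.
    by apply: (subvP (adapted W CW)); rewrite memv_cap memvf.
  rewrite /f /= (coord_span_filter (p := mem W) free_s gxspan) ?scale0r //.
  exact: N0.
(* Surjectivity of [g] makes the [i]-th coordinate functional nonzero. *)
have [x gx] := g_onto s`_i.
apply: (@has_rank_rank_one _ _ _ _ x).
  by rewrite /f /= gx coord_free // eqxx oner_neq0.
rewrite -(linear0 phi) (inj_eq phi_inj).
by apply: (free_not0 free_s); rewrite mem_nth // (eqP size_s0).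
Qed.
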